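(* Let $n\ge1$, $q\in[0,1)$, and let $s$ be a complex parameter. For generic $u$ let $\mathscr X_j(u)$, $j=0,1,\dots,n$, be the one-row operators built from the spin-$\frac12$ queue weights with parameters $s$ and $u$, and put $$\widehat{\mathscr X}_j(u)=(1-q)\,u\,\frac{\partial}{\partial u}\mathscr X_j(u),\qquad j=0,1,\dots,n .$$ Then for all $j,j'\in\{0,1,\dots,n\}$ the ''hat relation'' holds: $$\sum_{i,i'=0}^n\mathscr X_i(u)\,\mathscr X_{i'}(u)\,(\mathscr M_{loc})_{ii',jj'}=\mathscr X_j(u)\,\widehat{\mathscr X}_{j'}(u)-\widehat{\mathscr X}_j(u)\,\mathscr X_{j'}(u),$$ where $\mathscr M_{loc}$ is the local rate matrix of the multi-species ASEP.
   Context: **Local rates.** For $i,i',j,j'\in\{0,\dots,n\}$: for $i\neq i'$, $(\mathscr M_{loc})_{ii',i'i}=r(i,i')$ and $(\mathscr M_{loc})_{ii',ii'}=-r(i,i')$, where $r(i,i')=1$ if $i<i'$ and $r(i,i')=q$ if $i>i'$; all other entries are $0$. **Queue vertex weights with horizontal spin 1/2.** Fix $1\le m\le n$ and put $z=uq^{-1/2}$ (for $q=0$ one takes $z$ itself as the spectral parameter, with $u\,\partial_u$ read as $z\,\partial_z$; $q^0=1$ always). Let $\mathbf A,\mathbf C$ be $n$-tuples with $A_m=C_m=+\infty$ and all other coordinates in $\mathbb Z_{\ge0}$; $\mathbf e_i$ are standard basis vectors (adding or subtracting $\mathbf e_m$ changes nothing), $A_{[a,b]}=\sum_{i=a}^bA_i$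 (zero if $a>b$). Let $k\in\{0\}\cup\{m+1,\dots,n\}$ (color entering from the left, $0$ = none) and $\ell\in\{0,\dots,n\}$ (color exiting right). The weight $w^{(-m)}(\mathbf A,k;\mathbf C,\ell)$ ($\mathbf A$ enters from below, $\mathbf C$ exits above) equals $\frac1{1-sz}$ times: - $1$ for $(\mathbf A,0;\mathbf A,0)$ and for $(\mathbf A,k;\mathbf A+\mathbf e_k,0)$, $k>m$; - $-sz(1-q^{A_\ell})q^{A_{[\ell+1,n]}}$ for $(\mathbf A,0;\mathbf A-\mathbf e_\ell,\ell)$, $\ell>m$; - $-sz\,q^{A_{[m+1,n]}}$ for $(\mathbf A,0;\mathbf A,m)$; - $-s^2q^{A_{[m+1,n]}}$ for $(\mathbf A,k;\mathbf A+\mathbf e_k,m)$, $k>m$; - $-s(z-sq^{A_k})q^{A_{[k+1,n]}}$ for $(\mathbf A,k;\mathbf A,k)$, $k>m$; - $-sz(1-q^{A_\ell})q^{A_{[\ell+1,n]}}$ for $(\mathbf A,k;\mathbf A+\mathbf e_k-\mathbf e_\ell,\ell)$, $m<k<\ell$; - $-s^2(1-q^{A_\ell})q^{A_{[\ell+1,n]}}$ for $(\mathbf A,k;\mathbf A+\mathbf e_k-\mathbf e_\ell,\ell)$, $m<\ell<k$; and all other weights are $0$. **One-row operators.** Let $V_{-m}$ have basis $|\mathbf M(-m)\rangle$ indexed by tuples with $\mathbf M(-m)_m=+\infty$, $\mathbf M(-m)_i=0$ for $i<m$, $\mathbf M(-m)_i\in\mathbb Z_{\ge0}$ for $i>m$.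 The (infinite) matrix $\mathscr X_j(u)$ on $V_{-n}\otimes\cdots\otimes V_{-1}$ has matrix elements $$\langle\mathbf M(-n),\dots,\mathbf M(-1)|\mathscr X_j(u)|\mathbf M'(-n),\dots,\mathbf M'(-1)\rangle=\sum_{h_2,\dots,h_n}\ \prod_{m=1}^nw^{(-m)}\bigl(\mathbf M(-m),h_{m+1};\mathbf M'(-m),h_m\bigr),$$ with $h_{n+1}=0$, $h_1=j$, $h_m\in\{0,\dots,n\}$. Products are matrix products, $\langle\mathbf M|XY|\mathbf M''\rangle=\sum_{\mathbf M'}\langle\mathbf M|X|\mathbf M'\rangle\langle\mathbf M'|Y|\mathbf M''\rangle$ (finite sums). Derivatives are entrywise.
   Formalization: The right-hand side is proved with the opposite sign, as hat X_j X_{j'} − X_j hat X_{j'}; the printed sign fails already for n=1, (j,j')=(0,1), where the left side is (q−1)X_0X_1 and the printed right side is (1−q)X_0X_1. *)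

(* Defs.v *)
From HB Require Import structures.
From mathcomp Require Import all_boot all_order all_algebra.
From mathcomp Require Import all_classical all_reals all_analysis.
From mathcomp Require Import complex.

Set Implicit Arguments.
Unset Strict Implicit.
Unset Printing Implicit Defensive.

Import Order.TTheory GRing.Theory Num.Theory.
Import numFieldNormedType.Exports.

Local Open Scope classical_set_scope.
Local Open Scope complex_scope.
Local Open Scope ring_scope.

(* Colors are 0, ..., n, i.e. elements of 'I_n.+1; 0 means "no arrow".      *)
(* A tuple (A_1, ..., A_n) is stored as a function on all of {0, ..., n}, so *)
(* that coordinates and colors share their labels; coordinate 0 is a dummy   *)
(* which is zero in every basis vector. None stands for +oo.                 *)
Definition occupation (n : nat) : Type := {ffun 'I_n.+1 -> option nat}.
HB.instance Definition _ n := Choice.on (occupation n).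

Section Weights.
Variables (R : realType) (n : nat).
Implicit Types (A C : occupation n) (k l : 'I_n.+1).

(* A +- e_k; infinite coordinates are left unchanged. A - e_k is used only   *)
(* with a factor 1 - q^(A_k), so its value when A_k = 0 is irrelevant.       *)
Definition incr A k : occupation n :=
  [ffun i => if i == k then omap succn (A i) else A i].
Definition decr A k : occupation n :=
  [ffun i => if i == k then omap predn (A i) else A i].

(* A_i as a natural number; used only at coordinates where A_i is finite.    *)
Definition occ A (i : 'I_n.+1) : nat := odflt 0 (A i).

(* A_[k+1, n] *)
Definition occ_above A (k : nat) : nat := (\sum_(i < n.+1 | k < i) occ A i)%N.

(* z = u q^(-1/2), and z = u when q = 0.                                      *)
Definition spectral (q : R) (u : R[i]) : R[i] :=
  if q == 0 then u else u / (Num.sqrt q)%:C.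

Definition queue_weight_num (q : R) (s z : R[i]) (m : nat)
    A k C l : R[i] :=
  let Q (e : nat) : R[i] := q%:C ^+ e in
  let T (c : nat) : R[i] := Q (occ_above A c) in
  if k == 0%N :> nat then
    if l == 0%N :> nat then (C == A)%:R
    else if l == m :> nat then (C == A)%:R * (- s * z * T m)
    else if (m < l)%N then
      (C == decr A l)%:R * (- s * z * (1 - Q (occ A l)) * T l)
    else 0
  else if (m < k)%N then
    if l == 0%N :> nat then (C == incr A k)%:R
    else if l == m :> nat then (C == incr A k)%:R * (- s ^+ 2 * T m)
    else if l == k then (C == A)%:R * (- s * (z - s * Q (occ A k)) * T k)
    else if (k < l)%N then
      (C == decr (incr A k) l)%:R * (- s * z * (1 - Q (occ A l)) * T l)
    else if (m < l)%N then
      (C == decr (incr A k) l)%:R * (- s ^+ 2 * (1 - Q (occ A l)) * T l)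
    else 0
  else 0.

Definition queue_weight (q : R) (s u : R[i]) (m : nat) A k C l : R[i] :=
  let z := spectral q u in
  (1 - s * z)^-1 * queue_weight_num q s z m A k C l.

End Weights.

(* M(-m), 1 <= m <= n, is the component of index m - 1.                       *)
Definition is_row_basis (n : nat) (M : {ffun 'I_n -> occupation n}) : bool :=
  [forall m : 'I_n, forall i : 'I_n.+1,
     if (i < m.+1)%N then M m i == Some 0%N
     else if i == m.+1 :> nat then M m i == None
     else M m i != None].

(* Basis of V_(-n) (x) ... (x) V_(-1). *)
Definition row_basis (n : nat) : Type :=
  {M : {ffun 'I_n -> occupation n} | is_row_basis M}.
HB.instance Definition _ n := Choice.on (row_basis n).

Section Operators.
Variables (R : realType) (n : nat).

(* Infinite matrices; X M M' is the matrix element <M| X |M'>.               *)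
Definition operator : Type := row_basis n -> row_basis n -> R[i].

(* The sum over all of the basis is a finitely supported one; see            *)
(* row_operator_finite below.                                                *)
Definition opmul (X Y : operator) : operator := fun M M'' =>
  \sum_(M' \in [set: row_basis n]) X M M' * Y M' M''.

(* h_1, ..., h_(n+1) are the values of h at 0, ..., n.                       *)
Definition row_operator (q : R) (s : R[i]) (j : 'I_n.+1) (u : R[i]) :
    operator := fun M M' =>
  \sum_(h : {ffun 'I_n.+1 -> 'I_n.+1} | (h ord0 == j) && (h ord_max == ord0))
    \prod_(m < n) queue_weight q s u m.+1
      (val M m) (h (lift ord0 m)) (val M' m) (h (widen_ord (leqnSn n) m)).

Lemma row_operator_finite (q : R) (s : R[i]) (j : 'I_n.+1) (M : row_basis n) :
  finite_set [set M' | exists u, row_operator q s j u M M' != 0].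
Proof.
pose step A (a : ('I_n.+1 * 'I_n.+1) * (bool * bool)) : occupation n :=
  let B := if a.2.1 then incr A a.1.1 else A in
  if a.2.2 then decr B a.1.2 else B.
pose S := range (fun f : {ffun 'I_n -> ('I_n.+1 * 'I_n.+1) * (bool * bool)} =>
  [ffun m => step (val M m) (f m)] : {ffun 'I_n -> occupation n}).
have finS : finite_set (val @^-1` S : set (row_basis n)).
  apply: finite_preimage; first by move=> x y _ _; apply: val_inj.
  by apply: finite_image; apply: finite_finset.
apply: sub_finite_set finS => M' /= [u XM'].
have [h _ hN0] : exists2 h : {ffun 'I_n.+1 -> 'I_n.+1},
    (h ord0 == j) && (h ord_max == ord0) &
    \prod_(m < n) queue_weight q s u m.+1 (val M m) (h (lift ord0 m))
      (val M' m) (h (widen_ord (leqnSn n) m)) != 0.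
  apply/not_exists2P => H; move: XM'; rewrite /row_operator big1 ?eqxx// => h hP.
  by case: (H h) => // /negP; rewrite negbK => /eqP.
have wN0 m k C l A : queue_weight q s u m A k C l != 0 ->
    {a | C = step A a}.
  move=> w0; apply: cid; move: w0; rewrite /queue_weight /queue_weight_num /=.
  have st b1 b2 C' : C' = step A ((k, l), (b1, b2)) ->
      (C == C')%:R != 0 :> R[i] -> exists a, C = step A a.
    by move=> -> ; case: (C =P _) => [-> _|_]; [eexists | rewrite eqxx].
  rewrite mulf_eq0 negb_or => /andP[_].
  have st' b1 b2 C' x : C' = step A ((k, l), (b1, b2)) ->
      (C == C')%:R * x != 0 :> R[i] -> exists a, C = step A a.
    by move=> CE; rewrite mulf_eq0 negb_or => /andP[+ _]; apply: st CE.
  repeat case: ifP => _; rewrite ?eqxx //;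
    first [ exact: (st false false) | exact: (st true false)
          | exact: (st' false false) | exact: (st' true false)
          | exact: (st' false true) | exact: (st' true true)].
have wm (m : 'I_n) : queue_weight q s u m.+1 (val M m) (h (lift ord0 m))
      (val M' m) (h (widen_ord (leqnSn n) m)) != 0.
  by apply: contraNneq hN0 => w0; rewrite (bigD1 m)//= w0 mul0r.
exists [ffun m => sval (wN0 _ _ _ _ _ (wm m))] => //.
by apply/ffunP => m; rewrite !ffunE -(svalP (wN0 _ _ _ _ _ (wm m))).
Qed.

(* Pitfall: with these weights and rates the hat relation reads              *)
(*   sum_(i, i') X_i X_i' (M_loc)_(i i', j j') = hatX_j X_j' - X_j hatX_j',  *)
(* and the opposite sign on the right is already wrong for n = 1. There the  *)
(* operators are the scalars X_0 = 1 / (1 - s z), X_1 = - s z / (1 - s z),   *)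
(* and for (j, j') = (0, 1) the left-hand side is                            *)
(*   r(1, 0) X_1 X_0 - r(0, 1) X_0 X_1 = (q - 1) X_0 X_1,                    *)
(* whereas u d/du log (X_1 / X_0) = 1 gives                                  *)
(*   X_0 hatX_1 - hatX_0 X_1 = (1 - q) X_0 X_1.                              *)
Definition hat_row_operator (q : R) (s : R[i]) (j : 'I_n.+1) (u : R[i]) :
    operator := fun M M' =>
  (1 - q%:C) * u *
    derive1 (fun v : R[i] => row_operator q s j v M M' : R[i]^o) u.

Definition local_rate (q : R) (i i' : 'I_n.+1) : R[i] :=
  if (i < i')%N then 1 else q%:C.

(* The entry (M_loc)_(i i', j j'). *)
Definition M_loc (q : R) (i i' j j' : 'I_n.+1) : R[i] :=
  if i == i' then 0
  else if (j == i') && (j' == i) then local_rate q i i'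
  else if (j == i) && (j' == i') then - local_rate q i i'
  else 0.

End Operators.

(* Main.v *)
(* Let L_m be the matrix, indexed by pairs of horizontal colors, of weights of
   two vertices of row m stacked on top of each other. Matrix elements of
   X_i X_i' are the ((0,0), (i,i')) entries of L_n ... L_1. The theorem follows
   from a local relation
     L_m M_loc - M_loc L_m = (1 - q) (L_m^(e,w) - L_m^(w,e)),
   where L_m^(e,w) and L_m^(w,e) have the Euler derivative u d/du applied to
   the lower, resp. the upper, of the two vertices: the commutator with M_loc
   is a derivation of the product L_n ... L_1, and the row (0,0) of M_loc
   vanishes.
   The numerator of a vertex weight is affine in z. If it is a + b z, the local
   relation becomes polynomial, with right-hand side (1 - q) z (b*a - a*b), and
   is a finite list of identities, one for each relative order of the colors. *)
Require Import Defs.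
From HB Require Import structures.
From mathcomp Require Import all_boot all_order all_algebra.
From mathcomp Require Import all_classical all_reals all_analysis.
From mathcomp Require Import complex fraction.
From mathcomp Require Import ring zify.

Set Implicit Arguments.
Unset Strict Implicit.
Unset Printing Implicit Defensive.

Import Order.TTheory GRing.Theory Num.Theory.
Import numFieldNormedType.Exports.

Local Open Scope complex_scope.
Local Open Scope ring_scope.

(** * The exchange relation for a single row *)

(* The numerator of a queue weight, with x = q^(A_l) and T = q^(A_[l+1,n]). It
   is linear in (a, b) and the actual weight is the value at (1, z). Taking
   x = 0 = q^(+oo) makes l = m an instance of the case l > m. *)
Definition vertex (K : comPzRingType) (s a b x T : K) (k l : nat) : K :=
  if l == 0%N then a else
  - s * T * (if (k < l)%N then b * (1 - x)
             else if (l < k)%N then s * a * (1 - x) else b - s * a * x).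

Definition asep_rate (K : pzRingType) (q : K) (i j : nat) : K :=
  if (i < j)%N then 1 else q.

(* The effect of A |-> A + e_k - e_l on q^(A_i) and on q^(A_[i+1,n]). *)
Definition shift_x (K : fieldType) (q : K) (x : nat -> K) (k l i : nat) : K :=
  x i * q ^+ (k == i) / q ^+ (l == i).
Definition shift_T (K : fieldType) (q : K) (T : nat -> K) (k l i : nat) : K :=
  T i * q ^+ (i < k)%N / q ^+ (i < l)%N.

(** The lower vertex is (k, l), the upper one (k', l'), and the lower one acts on the upper only
    through the shifts. For each relative order of the colors this is an identity of rational
    functions in free values [x l], [T l]. *)
Lemma vertex_exchange (K : fieldType) (q s z : K) (x T : nat -> K)
    (k k' j j' : nat) : q != 0 ->
  let V a b a' b' k k' l l' := vertex s a b (x l) (T l) k l *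
    vertex s a' b' (shift_x q x k l l') (shift_T q T k l l') k' l' in
  asep_rate q j' j * V 1 z 1 z k k' j' j
  - asep_rate q j j' * V 1 z 1 z k k' j j'
  - asep_rate q k k' * (V 1 z 1 z k' k j j' - V 1 z 1 z k k' j j')
  = (1 - q) * z * (V 0 1 1 0 k k' j j' - V 1 0 0 1 k k' j j').
Proof.
move=> q0; rewrite /vertex /shift_x /shift_T /asep_rate /=.
(* Output color 0 is split off first, since its weight is [a] with no power of [q]. Color
   comparisons then select every branch, and [lia] discards inconsistent orders. *)
case: (posnP j) => [->|j0]; case: (posnP j') => [->|j'0];
  rewrite ?ltn0 ?(gtn_eqF j0) ?(gtn_eqF j'0) ?(ltn_eqF j0) ?(ltn_eqF j'0)
    ?j0 ?j'0 /=.
- by case: (ltngtP k k') => *; ring.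
- have [?|?|?] := ltngtP k k'; subst => //=;
  have [?|?|?] := ltngtP k' j'; subst => //=;
  try (have [?|?|?] := ltngtP k j'; subst => //=); try (exfalso; lia);
  rewrite ?ltnn ?eqxx /=; field; by rewrite ?q0 ?oner_neq0.
- have [?|?|?] := ltngtP k k'; subst => //=;
  have [?|?|?] := ltngtP k' j; subst => //=;
  try (have [?|?|?] := ltngtP k j; subst => //=); try (exfalso; lia);
  rewrite ?ltnn ?eqxx /=; field; by rewrite ?q0 ?oner_neq0.
have [?|?|?] := ltngtP k k'; subst => //=;
have [?|?|?] := ltngtP k' j'; subst => //=;
try (have [?|?|?] := ltngtP k j'; subst => //=); try (exfalso; lia);
try (have [?|?|?] := ltngtP k j; subst => //=); try (exfalso; lia);
try (have [?|?|?] := ltngtP k' j; subst => //=); try (exfalso; lia);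
try (have [?|?|?] := ltngtP j j'; subst => //=); try (exfalso; lia);
rewrite ?ltnn ?eqxx /=; field; by rewrite ?q0 ?oner_neq0.
Qed.

(** * Occupation tuples of one row and their moves *)

Section Rows.
Variable n : nat.
Implicit Types (A C : occupation n) (k l i : 'I_n.+1) (m : nat).

Definition row_ok m A : bool :=
  [forall i : 'I_n.+1,
     if (i < m)%N then A i == Some 0%N
     else if i == m :> nat then A i == None else A i != None].

(** The guards reflect that coordinate m is infinite and coordinate 0 a dummy: colors up to m leave
    [A] unchanged. *)
Definition step m A k l : occupation n :=
  let B := if (m < k)%N then incr A k else A in
  if (m < l)%N then decr B l else B.

Lemma row_ok_occ m A i : row_ok m A -> (m < i)%N -> A i = Some (occ A i).
Proof.
move=> /forallP/(_ i) + mi; rewrite ltnNge (ltnW mi) gtn_eqF//= /occ.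
by case: (A i).
Qed.

Lemma stepE m A k l i : row_ok m A ->
  step m A k l i =
  if (m < i)%N then Some (occ A i + (k == i) - (l == i))%N else A i.
Proof.
move=> Aok; rewrite /step (eq_sym k) (eq_sym l).
have above j : i == j -> (m < i)%N = (m < j)%N by move=> /eqP ->.
have Ai : A i = if (m < i)%N then Some (occ A i) else A i.
  by case: ifP => // /(row_ok_occ Aok).
case mi: (m < i)%N; case mk: (m < k)%N; case ml: (m < l)%N;
  rewrite ?ffunE 1?Ai ?mi //;
  have [/above|_] := boolP (i == l); have [/above|_] := boolP (i == k);
  by rewrite ?mi ?ml ?mk //= ?addn0 ?addn1 ?subn0 ?subn1.
Qed.

Lemma row_ok_step m A k l : row_ok m A -> row_ok m (step m A k l).
Proof.
move=> Aok; apply/forallP => i; rewrite (stepE _ _ _ Aok).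
move/forallP: Aok => /(_ i); case: (ltngtP i m) => //.
Qed.

Lemma occ_step m A k l i : row_ok m A -> (m < i)%N ->
  occ (step m A k l) i = (occ A i + (k == i) - (l == i))%N.
Proof. by move=> Aok mi; rewrite {1}/occ (stepE _ _ _ Aok) mi. Qed.

(* Rules out truncation in step; where it fails, the weight is 0. *)
Definition removable m A k l := (m < l)%N ==> (0 < occ A l + (k == l))%N.

(** Without truncation in the first subtraction, all additions can be moved ahead of all
    subtractions. *)
Lemma step_stepE m A k l k' l' i : row_ok m A -> removable m A k l ->
  step m (step m A k l) k' l' i =
  if (m < i)%N
  then Some (occ A i + (k == i) + (k' == i) - (l == i) - (l' == i))%N
  else A i.
Proof.
move=> Aok rem; rewrite (stepE _ _ _ (row_ok_step k l Aok)) (stepE _ _ _ Aok).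
case: ifP => mi; last by rewrite mi.
rewrite occ_step//; congr (Some (_ - _)%N).
move: rem; rewrite /removable; have [->|_] := eqVneq l i; last by lia.
by rewrite mi /=; lia.
Qed.

Lemma sum_above_eq (i k : 'I_n.+1) :
  (\sum_(p < n.+1 | i < p) (k == p) = (i < k))%N.
Proof.
rewrite big_mkcond (bigD1 k)//= eqxx big1 ?addn0; first by case: ltnP.
by move=> p pk; rewrite eq_sym (negbTE pk) if_same.
Qed.

Lemma occ_above_step m A k l i :
  row_ok m A -> removable m A k l -> (m <= i)%N ->
  (occ_above (step m A k l) i + (i < l) = occ_above A i + (i < k))%N.
Proof.
move=> Aok rem mi; rewrite /occ_above -!sum_above_eq -!big_split /=.
apply: eq_bigr => p ip; have mp := leq_ltn_trans mi ip; rewrite occ_step//.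
move: rem; rewrite /removable; have [->|_] := eqVneq l p; last by lia.
by rewrite mp /=; lia.
Qed.

(** * Row weights over a commutative ring *)

Section RingWeights.
Variable K : comPzRingType.
Implicit Types (q s z a b : K).

(** The value 0 stands for q^(+oo). Natural-number arguments match [vertex_exchange]; [inord]
    returns to colors. *)
Definition xocc q m A (l : nat) : K :=
  if l == m then 0 else q ^+ occ A (inord l).

(** A condition on [k] times a condition on [l]: admissibility of a pair of vertices is thus
    invariant under swapping the two inputs or the two outputs. *)
Definition allowed m (k l : nat) :=
  ((k == 0) || (m < k))%N && ((l == 0) || (m <= l))%N.

Definition affine_weight q s a b m A k l : K :=
  if allowed m k l
  then vertex s a b (xocc q m A l) (q ^+ occ_above A l) k l else 0.

(** An entry of the two-vertex matrix L_m. The middle tuple is determined by [A], [k] and [l], so no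
    summation remains. *)
Definition pair_weight q s a b a' b' m A C (k k' l l' : 'I_n.+1) : K :=
  affine_weight q s a b m A k l *
  affine_weight q s a' b' m (step m A k l) k' l' *
  (C == step m (step m A k l) k' l')%:R.

(** Here l > m, A_l = 0 and k differs from l, so the weight is 0 or contains 1 - q^0 = 0. *)
Lemma affine_weight_removable q s a b m A k l :
  ~~ removable m A k l -> affine_weight q s a b m A k l = 0.
Proof.
rewrite /removable negb_imply -leqNgt leqn0 addn_eq0.
move=> /andP[ml /andP[/eqP A0 kl]].
rewrite /affine_weight; case: ifP => // _.
rewrite /vertex /xocc inord_val A0 (gtn_eqF ml) expr0 subrr !mulr0.
have /negPf -> : l != 0%N :> nat by rewrite -lt0n (leq_ltn_trans (leq0n m) ml).
have : k != l :> nat by apply: contraTneq kl => /val_inj ->; rewrite eqxx.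
by case: ltngtP => //; rewrite !mulr0.
Qed.

End RingWeights.

(** The weights are polynomial in the parameters; this lets identities pass from an indeterminate
    [q] to its values. *)
Lemma affine_weightM (K L : comPzRingType) (f : {rmorphism K -> L})
    (q s a b : K) m A k l :
  f (affine_weight q s a b m A k l) =
  affine_weight (f q) (f s) (f a) (f b) m A k l.
Proof.
rewrite /affine_weight /vertex /xocc.
by do !case: ifP => _; rewrite ?rmorph0 // ?rmorphM ?rmorphN ?rmorphB ?rmorphM
  ?rmorphB ?rmorphM ?rmorphXn ?rmorph1 ?rmorph0.
Qed.

Lemma pair_weightM (K L : comPzRingType) (f : {rmorphism K -> L})
    (q s a b a' b' : K) m A C k k' l l' :
  f (pair_weight q s a b a' b' m A C k k' l l') =
  pair_weight (f q) (f s) (f a) (f b) (f a') (f b') m A C k k' l l'.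
Proof. by rewrite /pair_weight !rmorphM !affine_weightM rmorph_nat. Qed.

(** The difference of the two sides of the local relation, without denominators, so that it makes
    sense over polynomial rings. *)
Definition exchange_defect (K : comPzRingType) (q s z : K) m A C
    (k k' j j' : 'I_n.+1) : K :=
  let W := pair_weight q s 1 z 1 z m A C in
  asep_rate q j' j * W k k' j' j - asep_rate q j j' * W k k' j j'
  - asep_rate q k k' * (W k' k j j' - W k k' j j')
  - (1 - q) * z * (pair_weight q s 0 1 1 0 m A C k k' j j'
                   - pair_weight q s 1 0 0 1 m A C k k' j j').

Lemma exchange_defectM (K L : comPzRingType) (f : {rmorphism K -> L})
    (q s z : K) m A C k k' j j' :
  f (exchange_defect q s z m A C k k' j j') =
  exchange_defect (f q) (f s) (f z) m A C k k' j j'.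
Proof.
have rateM a b : f (asep_rate q a b) = asep_rate (f q) a b.
  by rewrite /asep_rate; case: ifP; rewrite ?rmorph1.
rewrite /exchange_defect !(pair_weightM, rateM, rmorphB, rmorphM).
by rewrite !(rmorph1, rmorph0).
Qed.

(** * The local relation for invertible q *)

Section FieldWeights.
Variables (K : fieldType) (q s : K).
Hypothesis q_neq0 : q != 0.

Lemma affine_weight_step (a b : K) m A k l k' l' :
  row_ok m A -> removable m A k l ->
  affine_weight q s a b m (step m A k l) k' l' =
  if allowed m k' l'
  then vertex s a b (shift_x q (xocc q m A) k l l')
         (shift_T q (fun c : nat => q ^+ occ_above A c) k l l') k' l'
  else 0.
Proof.
move=> Aok rem; rewrite /affine_weight; case: ifP => // /andP[_].
move=> /orP[/eqP l'0|ml']; first by rewrite /vertex l'0.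
congr vertex.
  rewrite /shift_x /xocc inord_val; case: ifP => [_|/negbT l'm].
    by rewrite !mul0r.
  have {l'm}ml' : (m < l')%N by rewrite ltn_neqAle eq_sym l'm.
  rewrite occ_step// exprB ?unitfE// ?exprD//.
  move: rem; rewrite /removable; have [->|_] := eqVneq l l'; last by lia.
  by rewrite ml' /=; lia.
(* Multiplying by q^[l' < l] turns the quotient into the additive identity [occ_above_step]. *)
rewrite /shift_T; apply: (mulIf (expf_neq0 (l' < l)%N q_neq0)).
by rewrite divfK ?expf_neq0// -!exprD occ_above_step.
Qed.

(** Two successive moves in a form symmetric in [k], [k'] and in [l], [l']. *)
Definition pair_target m A k k' l l' : occupation n :=
  [ffun i : 'I_n.+1 => if (m < i)%N
   then Some (occ A i + (k == i) + (k' == i) - (l == i) - (l' == i))%N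
   else A i].

(** If the first move is not removable, the target may differ from two successive steps, but the
    lower weight vanishes on both sides. *)
Lemma pair_weightE (a b a' b' : K) m A C k k' l l' : row_ok m A ->
  pair_weight q s a b a' b' m A C k k' l l' =
  (C == pair_target m A k k' l l')%:R *
  (if allowed m k l && allowed m k' l' then
     vertex s a b (xocc q m A l) (q ^+ occ_above A l) k l *
     vertex s a' b' (shift_x q (xocc q m A) k l l')
       (shift_T q (fun c : nat => q ^+ occ_above A c) k l l') k' l'
   else 0).
Proof.
move=> Aok; have [rem|nrem] := boolP (removable m A k l).
  rewrite /pair_weight affine_weight_step// /affine_weight.
  have -> : step m (step m A k l) k' l' = pair_target m A k k' l l'.
    by apply/ffunP => i; rewrite step_stepE// ffunE.
  by case: ifP; case: ifP; rewrite /= ?mulr0 ?mul0r// => _ _; rewrite mulrC.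
have := affine_weight_removable q s a b nrem.
rewrite /pair_weight => ->; rewrite !mul0r.
have := affine_weight_removable q s a b nrem; rewrite /affine_weight.
by case: (allowed m k l); rewrite ?mulr0// => ->; rewrite mul0r if_same mulr0.
Qed.

(** All pair weights in the defect share one target and one admissibility condition; these factor
    out and leave [vertex_exchange]. *)
Lemma exchange_defect_unit (z : K) m A C (k k' j j' : 'I_n.+1) : row_ok m A ->
  exchange_defect q s z m A C k k' j j' = 0.
Proof.
move=> Aok; rewrite /exchange_defect !pair_weightE//.
have -> : pair_target m A k k' j' j = pair_target m A k k' j j'.
  by apply/ffunP => i; rewrite !ffunE subnAC.
have -> : pair_target m A k' k j j' = pair_target m A k k' j j'.
  by apply/ffunP => i; rewrite !ffunE -!(addnAC _ (k == i)).
have [g1 g2] :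
    allowed m k j' && allowed m k' j = allowed m k j && allowed m k' j' /\
    allowed m k' j && allowed m k j' = allowed m k j && allowed m k' j'.
  rewrite /allowed; split; first by rewrite andbACA [X in _ && X]andbC andbACA.
  by rewrite [LHS]andbC andbACA [X in _ && X]andbC andbACA.
rewrite g1 g2; case: ifP => _; last by rewrite !mulr0 !subrr !mulr0 !subr0.
have := vertex_exchange s z (xocc q m A) (fun c : nat => q ^+ occ_above A c)
  k k' j j' q_neq0.
set c := (C == _)%:R => /= E; apply/eqP; rewrite subr_eq0; apply/eqP.
rewrite -!mulrBr [RHS]mulrCA -E; ring.
Qed.

End FieldWeights.

(* For fixed A and C the defect is a polynomial in q, s and z, so the case
   q = 0 follows from that of an indeterminate q. *)
Lemma exchange_defect_eq0 (K : fieldType) (q s z : K) m A C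
    (k k' j j' : 'I_n.+1) : row_ok m A ->
  exchange_defect q s z m A C k k' j j' = 0.
Proof.
move=> Aok; have X0 : tofrac ('X : {poly K}) != 0.
  by rewrite tofrac_eq0 polyX_eq0.
have := exchange_defect_unit (tofrac s%:P) X0 (tofrac z%:P) C k k' j j' Aok.
rewrite -exchange_defectM => /eqP; rewrite tofrac_eq0 => /eqP.
move=> /(congr1 (horner_eval q)); rewrite exchange_defectM /=.
by rewrite /horner_eval hornerX !hornerC.
Qed.

End Rows.

(** * Telescoping along paths *)

Section PathSums.
Variables (K : comPzRingType) (T : finType).

(** The entry (x, y) of the ordered product F_(N-1) ... F_0: a path starts at the column index [y]
    and ends at the row index [x]. *)
Definition path_sum (N : nat) (F : 'I_N -> T -> T -> K) (x y : T) : K :=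
  \sum_(p : {ffun 'I_N.+1 -> T} | (p ord0 == y) && (p ord_max == x))
    \prod_(m < N) F m (p (lift ord0 m)) (p (widen_ord (leqnSn N) m)).

Lemma eq_path_sum (N : nat) (F G : 'I_N -> T -> T -> K) (x y : T) :
  (forall m a b, F m a b = G m a b) -> path_sum F x y = path_sum G x y.
Proof. by move=> FG; apply: eq_bigr => p _; apply: eq_bigr. Qed.

Lemma path_sum0 (F : 'I_0 -> T -> T -> K) (x y : T) :
  path_sum F x y = (x == y)%:R.
Proof.
rewrite /path_sum; under eq_bigr do rewrite big_ord0.
have [<-|xy] := eqVneq x y; last first.
  rewrite big1// => p; rewrite (ord1 ord_max) => /andP[/eqP py /eqP px].
  by rewrite -py -px eqxx in xy.
rewrite (big_pred1 [ffun=> x]) // => p; rewrite (ord1 ord_max) andbb /=.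
apply/eqP/eqP => [px|->]; last by rewrite ffunE.
by apply/ffunP => i; rewrite ord1 ffunE.
Qed.

Lemma path_sumS (N : nat) (F : 'I_N.+1 -> T -> T -> K) (x y : T) :
  path_sum F x y =
  \sum_z path_sum (fun m => F (lift ord0 m)) x z * F ord0 z y.
Proof.
(* [ext] prepends a starting point to a path and [res] is its inverse; this peels off the rightmost
   factor F_0. *)
pose ext (p : T * {ffun 'I_N.+1 -> T}) : {ffun 'I_N.+2 -> T} :=
  [ffun i => if unlift ord0 i is Some i' then p.2 i' else p.1].
pose res (p : {ffun 'I_N.+2 -> T}) := (p ord0, [ffun i => p (lift ord0 i)]).
have extK : cancel ext res.
  move=> [t p]; congr pair; first by rewrite ffunE unlift_none.
  by apply/ffunP => i; rewrite !ffunE liftK.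
have resK : cancel res ext.
  move=> p; apply/ffunP => i; rewrite ffunE.
  by case: unliftP => [i' ->|->]; rewrite ?ffunE.
have ext0 p : ext p ord0 = p.1 by rewrite ffunE unlift_none.
have extS p i : ext p (lift ord0 i) = p.2 i by rewrite ffunE liftK.
have maxE : ord_max = lift ord0 ord_max :> 'I_N.+2 by apply: val_inj.
rewrite /path_sum (reindex ext) /=; last by exists res => p _.
rewrite (eq_bigl (fun p : T * {ffun 'I_N.+1 -> T} =>
  (p.1 == y) && (p.2 ord_max == x))); last first.
  by move=> p; rewrite ext0 maxE extS.
rewrite -(pair_big (fun t => t == y)
  (fun p : {ffun 'I_N.+1 -> T} => p ord_max == x) (fun t p =>
  \prod_(m < N.+1) F m (ext (t, p) (lift ord0 m))
    (ext (t, p) (widen_ord (leqnSn N.+1) m)))) /= big_pred1_eq.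
under [RHS]eq_bigr do rewrite mulr_suml.
rewrite (partition_big (fun p : {ffun _ -> T} => p ord0) predT)//=.
apply: eq_bigr => z _; apply: eq_big => [p|p /andP[_ /eqP pz]].
  by rewrite andbC.
rewrite big_ord_recl mulrC; congr (_ * _).
  apply: eq_bigr => m _; rewrite extS /=; congr F.
  have -> : widen_ord (leqnSn N.+1) (lift ord0 m) =
            lift ord0 (widen_ord (leqnSn N) m) by apply: val_inj.
  by rewrite extS.
rewrite extS pz; congr F.
have -> : widen_ord (leqnSn N.+1) ord0 = ord0 by apply: val_inj.
by rewrite ext0.
Qed.

Lemma path_sum_commutator (N : nat) (F D : 'I_N -> T -> T -> K)
    (M : T -> T -> K) (x y : T) :
  (forall m a b, \sum_c F m a c * M c b - \sum_c M a c * F m c b = D m a b) ->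
  \sum_c path_sum F x c * M c y - \sum_c M x c * path_sum F c y =
  \sum_(m0 < N) path_sum (fun m => if m == m0 then D m else F m) x y.
Proof.
elim: N F D x y => [|N IH] F D x y FD.
  rewrite big_ord0; under eq_bigr do rewrite path_sum0.
  under [X in _ - X]eq_bigr do rewrite path_sum0.
  rewrite (bigD1 x)//= eqxx mul1r big1 => [|c cx]; last first.
    by rewrite eq_sym (negbTE cx) mul0r.
  rewrite (bigD1 y)//= eqxx mulr1 big1 => [|c cx]; last first.
    by rewrite (negbTE cx) mulr0.
  by rewrite subrr.
rewrite big_ord_recl /=.
pose G (m : 'I_N) := F (lift ord0 m); pose E (m : 'I_N) := D (lift ord0 m).
(* This is [G F_0, M] = G [F_0, M] + [G, M] F_0; the terms G M F_0 cancel. *)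
transitivity (\sum_z path_sum G x z * D ord0 z y +
    \sum_z (\sum_c path_sum G x c * M c z - \sum_c M x c * path_sum G c z)
      * F ord0 z y).
  under eq_bigr do rewrite path_sumS -/G mulr_suml.
  under [X in _ - X]eq_bigr do rewrite path_sumS -/G mulr_sumr.
  under [X in _ = X + _]eq_bigr do rewrite -FD mulrBr !mulr_sumr.
  under [X in _ = _ + X]eq_bigr do rewrite mulrBl !mulr_suml.
  rewrite !sumrB exchange_big /=.
  rewrite [X in _ = _ + (X - _)]exchange_big /=.
  rewrite [X in _ = _ + (_ - X)]exchange_big /=.
  under [X in _ = _ + (X - _)]eq_bigr do under eq_bigr do rewrite -mulrA.
  rewrite addrA subrK.
  congr (_ - _); apply: eq_bigr => a _; apply: eq_bigr => b _;
    by rewrite mulrA.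
congr (_ + _).
  rewrite path_sumS eqxx; apply: eq_bigr => z _; congr (_ * _).
have IHz z := IH G E x z (fun m => FD (lift ord0 m)).
under [LHS]eq_bigr => z _ do rewrite IHz mulr_suml.
rewrite exchange_big; apply: eq_bigr => m0 _; rewrite path_sumS /=.
by apply: eq_bigr => z _; congr (_ * _); exact: eq_path_sum.
Qed.

End PathSums.

(** A path of pairs is a pair of paths, so two stacked rows become one product of matrices on color
    pairs. *)
Lemma path_sum_pair (K : comPzRingType) (T U : finType) (N : nat)
    (F : 'I_N -> T * U -> T * U -> K) (x y : T) (x' y' : U) :
  path_sum F (x, x') (y, y') =
  \sum_(p : {ffun 'I_N.+1 -> T} | (p ord0 == y) && (p ord_max == x))
  \sum_(p' : {ffun 'I_N.+1 -> U} | (p' ord0 == y') && (p' ord_max == x'))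
    \prod_(m < N) F m (p (lift ord0 m), p' (lift ord0 m))
      (p (widen_ord (leqnSn N) m), p' (widen_ord (leqnSn N) m)).
Proof.
rewrite pair_big /path_sum /=.
rewrite (reindex (fun r : {ffun 'I_N.+1 -> T} * {ffun 'I_N.+1 -> U} =>
   [ffun i => (r.1 i, r.2 i)])) /=; last first.
  exists (fun p : {ffun 'I_N.+1 -> T * U} =>
     ([ffun i => (p i).1], [ffun i => (p i).2])) => [[r r']|p] _ /=.
    by congr pair; apply/ffunP => i; rewrite !ffunE.
  by apply/ffunP => i; rewrite !ffunE -surjective_pairing.
apply: eq_big => [r|r _]; first by rewrite !ffunE !xpair_eqE andbACA.
by apply: eq_bigr => m _; rewrite !ffunE.
Qed.

Lemma path_sum_at (K : comPzRingType) (T : finType) (N : nat)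
    (F G H : 'I_N -> T -> T -> K) (c : K) (m0 : 'I_N) (x y : T) :
  path_sum (fun m => if m == m0
                     then fun a b => c * (G m a b - H m a b) else F m) x y =
  c * (path_sum (fun m => if m == m0 then G m else F m) x y
       - path_sum (fun m => if m == m0 then H m else F m) x y).
Proof.
rewrite /path_sum -sumrB mulr_sumr; apply: eq_bigr => p _.
rewrite (bigD1 m0)//= eqxx [X in _ = _ * (X - _)](bigD1 m0)//= eqxx.
rewrite [X in _ = _ * (_ - X)](bigD1 m0)//= eqxx.
rewrite -mulrA; congr (_ * _); rewrite mulrBl.
by congr (_ * _ - _ * _); apply: eq_bigr => m /negPf ->.
Qed.

Lemma natr_forall (K : comPzRingType) (I : finType) (b : pred I) :
  [forall i, b i]%:R = \prod_i (b i)%:R :> K.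
Proof.
have [/forallP bT|/forallPn[i /negPf bi]] := boolP [forall i, b i].
  by rewrite big1// => i _; rewrite bT.
by rewrite (bigD1 i)//= bi mul0r.
Qed.

(** * Derivatives *)

Definition has_derivative (F : numFieldType) (f : F -> F) (u d : F) : Prop :=
  is_derive u 1 (f : F -> F^o) d.

Section Derivatives.
Variable F : numFieldType.
Implicit Types (u : F).

Lemma has_derivative_derive1 (f : F -> F) u d :
  has_derivative f u d -> derive1 (f : F -> F^o) u = d.
Proof.
by move=> fd; rewrite derive1E; exact: (@derive_val _ _ _ _ _ _ _ fd).
Qed.

Lemma has_derivativeM (f g : F -> F) u df dg :
  has_derivative f u df -> has_derivative g u dg ->
  has_derivative (fun v => f v * g v) u (f u * dg + g u * df).
Proof. exact: is_deriveM. Qed.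

Lemma has_derivativeZ (c : F) (f : F -> F) u df :
  has_derivative f u df -> has_derivative (fun v => c * f v) u (c * df).
Proof. exact: is_deriveZ. Qed.

Lemma has_derivative_affine (a b u : F) :
  has_derivative (fun v => a + b * v) u b.
Proof.
have := is_deriveD (is_derive_cst (a : F^o) u 1)
  (is_deriveZ b (is_derive_id u (1 : F^o))).
by congr is_derive; rewrite /= ?add0r /GRing.scale /= ?mulr1.
Qed.

(** Leibniz rule with one factor replaced at a time, the same shape as the sum in
    [path_sum_commutator]. *)
Lemma has_derivative_prod (N : nat) (f : 'I_N -> F -> F) (df : 'I_N -> F) u :
  (forall m, has_derivative (f m) u (df m)) ->
  has_derivative (fun v => \prod_(m < N) f m v) u
    (\sum_(m0 < N) \prod_(m < N) (if m == m0 then df m else f m u)).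
Proof.
elim: N f df => [|N IH] f df fdf.
  rewrite big_ord0 (_ : (fun v => _) = cst 1); first exact: is_derive_cst.
  by apply/funext => v; rewrite big_ord0.
have := has_derivativeM (fdf ord0) (IH _ _ (fun m => fdf (lift ord0 m))).
congr (has_derivative _ _ _).
  by apply/funext => v; rewrite big_ord_recl.
rewrite big_ord_recl big_ord_recl /= addrC mulrC; congr (_ + _).
rewrite mulr_sumr; apply: eq_bigr => m0 _.
by rewrite big_ord_recl.
Qed.

Lemma has_derivative_sum (I : Type) (r : seq I) (P : pred I) (f : I -> F -> F)
    (df : I -> F) u : (forall i, has_derivative (f i) u (df i)) ->
  has_derivative (fun v => \sum_(i <- r | P i) f i v) u
    (\sum_(i <- r | P i) df i).
Proof.
move=> fdf; elim: r => [|i r IH].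
  rewrite big_nil (_ : (fun v => _) = cst 0); first exact: is_derive_cst.
  by apply/funext => v; rewrite big_nil.
rewrite big_cons (_ : (fun v => _) = if P i
    then (fun v => f i v + \sum_(i <- r | P i) f i v)
    else (fun v => \sum_(i <- r | P i) f i v)).
  by case: (P i) => //; exact: (is_deriveD (fdf i) IH).
by apply/funext => v; rewrite big_cons; case: ifP.
Qed.

(** With z = c v, the z-derivative of (a + b z) / (1 - s z) is (b + s a) / (1 - s z)^2; the chain
    rule supplies [c]. *)
Lemma has_derivative_spectral (s c a b u : F) : 1 - s * (c * u) != 0 ->
  has_derivative (fun v => (1 - s * (c * v))^-1 * (1 * a + c * v * b)) u
    ((1 - s * (c * u)) ^- 2 * c * (b + s * a)).
Proof.
move=> den0.
have dden : has_derivative (fun v => 1 - s * (c * v)) u (- (s * c)).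
  have := has_derivative_affine 1 (- (s * c)) u.
  by congr has_derivative; apply/funext => v; rewrite mulNr mulrA.
have dinv : has_derivative (fun v => (1 - s * (c * v))^-1) u
    ((1 - s * (c * u)) ^- 2 * (s * c)).
  have [dd _] := dden; apply: DeriveDef; first exact: derivableV.
  pose f v : F^o := 1 - s * (c * v).
  have -> := @deriveV _ _ f u 1 den0 dd.
  have -> : 'D_1 f u = - (s * c) by exact: (@derive_val _ _ _ _ _ _ _ dden).
  by rewrite /GRing.scale /= mulrNN.
have := has_derivativeM dinv (has_derivative_affine a (c * b) u).
congr has_derivative; last by field.
by apply/funext => v; congr (_ * _); ring.
Qed.

End Derivatives.

(** * Row operators *)

Lemma asep_rate_sumr (R : realType) (n : nat) (q : R)
    (G : 'I_n.+1 * 'I_n.+1 -> R[i]) (j j' : 'I_n.+1) :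
  \sum_c G c * M_loc q c.1 c.2 j j' =
  asep_rate q%:C j' j * G (j', j) - asep_rate q%:C j j' * G (j, j').
Proof.
have [->|jj'] := eqVneq j j'.
  rewrite subrr big1// => -[a b] _; rewrite /M_loc /=.
  have [|ab] := eqVneq a b; first by rewrite mulr0.
  have E : (j' == b) && (j' == a) = false.
    by apply: contraNF ab => /andP[/eqP <- /eqP <-].
  by rewrite E andbC E mulr0.
rewrite (bigD1 (j', j))//= (bigD1 (j, j')) /=; last first.
  by rewrite xpair_eqE negb_and jj'.
rewrite big1 ?addr0 => [|[a b] /andP[]].
  rewrite /M_loc /= eq_sym (negbTE jj') !eqxx /=.
  by rewrite /local_rate /asep_rate mulrN ![G _ * _]mulrC.
rewrite !xpair_eqE /M_loc /= !(eq_sym a) !(eq_sym b).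
rewrite andbC => /negPf -> /negPf ->.
by rewrite if_same mulr0.
Qed.

(** An off-diagonal row has two opposite entries, and a row with k = k' is zero; in particular the
    boundary row (0, 0) vanishes. *)
Lemma asep_rate_suml (R : realType) (n : nat) (q : R)
    (G : 'I_n.+1 * 'I_n.+1 -> R[i]) (k k' : 'I_n.+1) :
  \sum_c M_loc q k k' c.1 c.2 * G c =
  asep_rate q%:C k k' * (G (k', k) - G (k, k')).
Proof.
have [->|kk'] := eqVneq k k'.
  by rewrite subrr mulr0 big1// => -[a b] _; rewrite /M_loc eqxx mul0r.
rewrite (bigD1 (k', k))//= (bigD1 (k, k')) /=; last first.
  by rewrite xpair_eqE negb_and kk'.
rewrite big1 ?addr0 => [|[a b] /andP[]].
  rewrite /M_loc /= (negbTE kk') !eqxx /=.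
  by rewrite /local_rate /asep_rate mulrBr mulNr.
rewrite !xpair_eqE /M_loc /= (negbTE kk') => /negPf -> /negPf ->.
by rewrite mul0r.
Qed.

(** One [vertex] formula covers all families of weights: at l = m the value x = 0 turns 1 - x into
    1, and at l = k raising and lowering cancel. *)
Lemma queue_weight_numE (R : realType) (n : nat) (q : R) (s z : R[i]) (m : nat)
    (A : occupation n) (k : 'I_n.+1) (C : occupation n) (l : 'I_n.+1) :
  (0 < m)%N ->
  queue_weight_num q s z m A k C l =
  (C == step m A k l)%:R * affine_weight q%:C s 1 z m A k l.
Proof.
move=> m0; rewrite /queue_weight_num /affine_weight /allowed /vertex /xocc.
rewrite inord_val /step.
case: (posnP k) => [k0|k0]; last first.
  rewrite /=; case: (ltnP m k) => mk /=; last by rewrite mulr0.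
  case: (posnP l) => [l0|l0]; first by rewrite l0 /= mulr1.
  case: (ltngtP l m) => lm /=.
  - have lk : (l < k)%N := ltn_trans lm mk.
    have /negPf -> : l != k by rewrite -val_eqE /= ltn_eqF.
    by rewrite ltnNge (ltnW lk) /= mulr0.
  - have [->|lk] := eqVneq l k.
      rewrite ltnn; have -> : decr (incr A k) k = A.
        apply/ffunP => i; rewrite !ffunE; case: eqP => // _; by case: (A i).
      by congr (_ * _); ring.
    case: (ltngtP k l) => kl.
    + by congr (_ * _); ring.
    + by congr (_ * _); ring.
    + by move/val_inj: kl lk => ->; rewrite eqxx.
  - rewrite lm mk ltnNge (ltnW mk) /=; congr (_ * _); ring.
rewrite k0 /=; case: (posnP l) => [l0|l0]; first by rewrite l0 /= mulr1.
case: (ltngtP l m) => lm /=; first by rewrite mulr0.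
  by congr (_ * _); ring.
by rewrite lm; congr (_ * _); ring.
Qed.

Lemma affine_weight_linear (K : comPzRingType) (n : nat) (q s a b : K) (m : nat)
    (A : occupation n) (k l : 'I_n.+1) :
  affine_weight q s a b m A k l =
  a * affine_weight q s 1 0 m A k l + b * affine_weight q s 0 1 m A k l.
Proof. by rewrite /affine_weight /vertex; do ![case: ifP => _]; ring. Qed.

(** A Wronskian for z d/dz: the common factor 1 / (1 - s z) comes out squared, and the affine
    numerators leave z (b1 a2 - a1 b2). *)
Lemma euler_wedge (F : fieldType) (s z a1 b1 a2 b2 c : F) : 1 - s * z != 0 ->
  (1 - s * z) ^- 2 * z * (b1 + s * a1) *
    ((1 - s * z)^-1 * (1 * a2 + z * b2)) * c -
  (1 - s * z)^-1 * (1 * a1 + z * b1) *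
    ((1 - s * z) ^- 2 * z * (b2 + s * a2)) * c =
  (1 - s * z) ^- 2 * (z * (b1 * a2 * c - a1 * b2 * c)).
Proof. by move=> sz; field. Qed.

Lemma mul_common_factor (K : comPzRingType) (d a b c : K) :
  d * a * (d * b) * c = d ^+ 2 * (a * b * c).
Proof. by ring. Qed.

Lemma mul_common_rates (K : comPzRingType) (d r1 r2 r3 a b c : K) :
  r1 * (d * a) - r2 * (d * b) - r3 * (d * c - d * b) =
  d * (r1 * a - r2 * b - r3 * (c - b)).
Proof. by ring. Qed.

(** * Path expansion of the row operators and their products *)

Section Operators.
Variables (R : realType) (n : nat).
Implicit Types (M : row_basis n) (h : {ffun 'I_n.+1 -> 'I_n.+1}).

Lemma row_basis_ok M (m : 'I_n) : row_ok m.+1 (val M m).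
Proof. by have /forallP/(_ m) := valP M. Qed.

Fact row_target_proof M h : is_row_basis
  [ffun m : 'I_n =>
    step m.+1 (val M m) (h (lift ord0 m)) (h (widen_ord (leqnSn n) m))].
Proof.
by apply/forallP => m; rewrite ffunE; exact: row_ok_step (row_basis_ok M m).
Qed.

Definition row_target M h : row_basis n :=
  exist (fun N : {ffun 'I_n -> occupation n} => is_row_basis N) _
    (row_target_proof M h).

(** Each path has a single target, so every row of the infinite matrix has finite support. The free
    coefficient [c] covers both the operators and their Euler derivatives. *)
Definition path_operator (c : row_basis n -> {ffun 'I_n.+1 -> 'I_n.+1} -> R[i])
    (j : 'I_n.+1) : operator R n := fun M M' =>
  \sum_(h : {ffun 'I_n.+1 -> 'I_n.+1} | (h ord0 == j) && (h ord_max == ord0))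
    (M' == row_target M h)%:R * c M h.

Lemma opmul_path_operator c j (Y : operator R n) M M'' :
  opmul (path_operator c j) Y M M'' =
  \sum_(h : {ffun 'I_n.+1 -> 'I_n.+1} | (h ord0 == j) && (h ord_max == ord0))
    c M h * Y (row_target M h) M''.
Proof.
rewrite /opmul /path_operator.
(* [r] lists the finitely many candidates for the intermediate vector; all other summands vanish. *)
set r := undup (codom (row_target M)).
rewrite (@fsbigE _ _ _ _ _ r) ?undup_uniq//; last first.
  move=> M' _ M'r; rewrite big1 ?mul0r// => h _.
  case: eqP => [E|_]; last by rewrite mul0r.
  by move: M'r; rewrite E mem_undup codom_f.
under eq_bigl do rewrite in_setT.
under eq_bigr do rewrite mulr_suml.
rewrite exchange_big /=; apply: eq_bigr => h _.
rewrite (bigD1_seq (row_target M h)) ?undup_uniq ?mem_undup ?codom_f//= eqxx.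
rewrite mul1r big1 ?addr0// => M' /negPf ->; by rewrite !mul0r.
Qed.

Definition path_weight (f : 'I_n -> occupation n -> 'I_n.+1 -> 'I_n.+1 -> R[i])
    M h : R[i] :=
  \prod_(m < n) f m (val M m) (h (lift ord0 m)) (h (widen_ord (leqnSn n) m)).

Lemma row_target_eq M M' h :
  (M' == row_target M h)%:R = \prod_(m < n) (val M' m ==
     step m.+1 (val M m) (h (lift ord0 m)) (h (widen_ord (leqnSn n) m)))%:R
  :> R[i].
Proof.
rewrite -natr_forall; congr (nat_of_bool _)%:R; apply/eqP/forallP => [->|E] /=.
  by move=> m; rewrite ffunE.
by apply/val_inj/ffunP => m; rewrite ffunE; apply/eqP.
Qed.

Definition two_row
    (f g : 'I_n -> occupation n -> 'I_n.+1 -> 'I_n.+1 -> R[i]) M M''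
    (m : 'I_n) (x y : 'I_n.+1 * 'I_n.+1) : R[i] :=
  let B := step m.+1 (val M m) x.1 y.1 in
  f m (val M m) x.1 y.1 * g m B x.2 y.2 *
    (val M'' m == step m.+1 B x.2 y.2)%:R.

Lemma opmul_path_weight f g j j' M M'' :
  opmul (path_operator (path_weight f) j)
    (path_operator (path_weight g) j') M M'' =
  path_sum (two_row f g M M'') (ord0, ord0) (j, j').
Proof.
rewrite opmul_path_operator path_sum_pair; apply: eq_bigr => h _.
rewrite mulr_sumr; apply: eq_bigr => h' _.
rewrite row_target_eq /path_weight -!big_split /=; apply: eq_bigr => m _.
by rewrite ffunE /two_row /=; ring.
Qed.

Section Weights.
Variables (q : R) (s : R[i]).

Definition weight (u : R[i]) (m : 'I_n) (A : occupation n) (k l : 'I_n.+1) :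
    R[i] :=
  (1 - s * spectral q u)^-1 * affine_weight q%:C s 1 (spectral q u) m.+1 A k l.

(* The value of u d/du weight at u. *)
Definition euler_weight (u : R[i]) (m : 'I_n) (A : occupation n)
    (k l : 'I_n.+1) : R[i] :=
  let z := spectral q u in
  (1 - s * z) ^- 2 * z * (affine_weight q%:C s 0 1 m.+1 A k l
                          + s * affine_weight q%:C s 1 0 m.+1 A k l).

Lemma row_operatorE j u M M' :
  row_operator q s j u M M' = path_operator (path_weight (weight u)) j M M'.
Proof.
apply: eq_bigr => h _; rewrite row_target_eq /path_weight -big_split /=.
apply: eq_bigr => m _; rewrite /queue_weight queue_weight_numE// /weight.
by rewrite mulrCA.
Qed.

Lemma hat_row_operatorE j u M M' : 1 - s * spectral q u != 0 ->
  hat_row_operator q s j u M M' = path_operator (fun M h => \sum_(m0 < n)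
    (1 - q%:C) * path_weight
      (fun m => if m == m0 then euler_weight u m else weight u m) M h) j M M'.
Proof.
move=> u_gen; rewrite /hat_row_operator.
(* With this constant z = c u for q = 0 and q > 0 alike. *)
pose c : R[i] := if q == 0 then 1 else (Num.sqrt q)%:C^-1.
have spE v : spectral q v = c * v.
  by rewrite /spectral /c; case: ifP => _; rewrite ?mul1r// mulrC.
(* The plain derivative d/du of [weight]; the factor u later turns c u into z and [dw] into
   [euler_weight]. *)
pose dw (m : 'I_n) (A : occupation n) (k l : 'I_n.+1) : R[i] :=
  (1 - s * spectral q u) ^- 2 * c *
  (affine_weight q%:C s 0 1 m.+1 A k l
   + s * affine_weight q%:C s 1 0 m.+1 A k l).
have dweight m A k l :
    has_derivative (fun v => weight v m A k l) u (dw m A k l).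
  move: u_gen; rewrite spE => u_gen'.
  have := has_derivative_spectral (affine_weight q%:C s 1 0 m.+1 A k l)
    (affine_weight q%:C s 0 1 m.+1 A k l) u_gen'.
  congr has_derivative; last by rewrite /dw spE.
  by apply/funext => v; rewrite /weight [in RHS]affine_weight_linear spE.
have drow : has_derivative (fun v => row_operator q s j v M M') u
   (\sum_(h : {ffun 'I_n.+1 -> 'I_n.+1} | (h ord0 == j) && (h ord_max == ord0))
     (M' == row_target M h)%:R * \sum_(m0 < n) \prod_(m < n)
       (if m == m0
        then dw m (val M m) (h (lift ord0 m)) (h (widen_ord (leqnSn n) m))
        else weight u m (val M m) (h (lift ord0 m))
               (h (widen_ord (leqnSn n) m)))).
  rewrite (_ : (fun v => _) =
    fun v => path_operator (path_weight (weight v)) j M M').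
    apply: has_derivative_sum => h; apply: has_derivativeZ.
    by apply: has_derivative_prod => m; apply: dweight.
  by apply/funext => v; rewrite row_operatorE.
rewrite (has_derivative_derive1 drow).
rewrite mulr_sumr; apply: eq_bigr => h _; rewrite mulrCA; congr (_ * _).
rewrite mulr_sumr; apply: eq_bigr => m0 _; rewrite -mulrA; congr (_ * _).
rewrite /path_weight (bigD1 m0)//= eqxx [RHS](bigD1 m0)//= eqxx mulrA;
  congr (_ * _).
  rewrite /dw /euler_weight !spE mulrC -!mulrA.
  by congr (_ * (_ * _)); rewrite mulrC.
by apply: eq_bigr => m /negPf ->.
Qed.

(** The local relation for the actual weights: [exchange_defect_eq0] times the square of 1 / (1 - s
    z), with [euler_wedge] giving the right-hand side. *)
Lemma two_row_commutator u M M'' (m : 'I_n) x y : 1 - s * spectral q u != 0 ->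
  let w := weight u in let e := euler_weight u in
  \sum_c two_row w w M M'' m x c * M_loc q c.1 c.2 y.1 y.2
  - \sum_c M_loc q x.1 x.2 c.1 c.2 * two_row w w M M'' m c y =
  (1 - q%:C) * (two_row e w M M'' m x y - two_row w e M M'' m x y).
Proof.
move=> u_gen w e; rewrite asep_rate_sumr asep_rate_suml.
set z := spectral q u; pose d := (1 - s * z)^-1.
pose pw a b a' b' (x y : 'I_n.+1 * 'I_n.+1) := pair_weight q%:C s a b a' b' m.+1
  (val M m) (val M'' m) x.1 x.2 y.1 y.2.
have wwE x' y' : two_row w w M M'' m x' y' = d ^+ 2 * pw 1 z 1 z x' y'.
  rewrite /two_row /w /weight /pw /pair_weight -/z -/d.
  exact: mul_common_factor.
have ewE : two_row e w M M'' m x y - two_row w e M M'' m x y =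
    d ^+ 2 * (z * (pw 0 1 1 0 x y - pw 1 0 0 1 x y)).
  rewrite /two_row /w /e /weight /euler_weight /pw /pair_weight -/z /=.
  rewrite [affine_weight _ s 1 z _ (val M m) _ _]affine_weight_linear.
  rewrite [affine_weight _ s 1 z _ (step _ _ _ _) _ _]affine_weight_linear.
  by rewrite /d exprVn; exact: euler_wedge.
have E := subr0_eq (exchange_defect_eq0 q%:C s z (val M'' m) x.1 x.2 y.1 y.2
  (row_basis_ok M m)).
rewrite ewE !wwE [RHS]mulrCA (mulrA (1 - q%:C) z) /pw /= -E.
exact: mul_common_rates.
Qed.

End Weights.
End Operators.

Theorem proposition4p15 (R : realType) (n : nat) (q : R) (s u : R[i])
    (n_ge1 : (1 <= n)%N) (q_ge0 : 0 <= q) (q_lt1 : q < 1)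
    (u_generic : 1 - s * spectral q u != 0)
    (j j' : 'I_n.+1) (M M'' : row_basis n) :
  \sum_(i < n.+1) \sum_(i' < n.+1)
      opmul (row_operator q s i u) (row_operator q s i' u) M M''
        * M_loc q i i' j j'
  = opmul (hat_row_operator q s j u) (row_operator q s j' u) M M''
    - opmul (row_operator q s j u) (hat_row_operator q s j' u) M M''.
Proof.
pose w := @weight R n q s u; pose e := @euler_weight R n q s u.
pose at0 m0 m := if m == m0 then e m else w m.
have rowE i : row_operator q s i u = path_operator (path_weight w) i.
  by apply/funext => N; apply/funext => N'; exact: row_operatorE.
have hatE i : hat_row_operator q s i u = path_operator (fun N h =>
    \sum_(m0 < n) (1 - q%:C) * path_weight (at0 m0) N h) i.
  by apply/funext => N; apply/funext => N'; exact: hat_row_operatorE.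
(* The left operator is the lower row, so its hat puts the Euler weight on the lower vertex of one
   component [m0]; in [hatrE] it falls on the upper vertex. *)
have hatlE : opmul (hat_row_operator q s j u) (row_operator q s j' u) M M'' =
    \sum_(m0 < n) (1 - q%:C) * path_sum (fun m => if m == m0
      then two_row e w M M'' m else two_row w w M M'' m) (ord0, ord0) (j, j').
  rewrite hatE rowE opmul_path_operator.
  under eq_bigr do rewrite mulr_suml.
  rewrite exchange_big /=; apply: eq_bigr => m0 _.
  under eq_bigr do rewrite -mulrA.
  rewrite -mulr_sumr -opmul_path_operator opmul_path_weight; congr (_ * _).
  by apply: eq_path_sum => m x y; rewrite /two_row /at0; case: ifP.
have hatrE : opmul (row_operator q s j u) (hat_row_operator q s j' u) M M'' =
    \sum_(m0 < n) (1 - q%:C) * path_sum (fun m => if m == m0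
      then two_row w e M M'' m else two_row w w M M'' m) (ord0, ord0) (j, j').
  have hatE' N N' : hat_row_operator q s j' u N N' = \sum_(m0 < n)
      (1 - q%:C) * path_operator (path_weight (at0 m0)) j' N N'.
    rewrite hatE /path_operator.
    under [RHS]eq_bigr do rewrite mulr_sumr.
    rewrite [RHS]exchange_big /=; apply: eq_bigr => h _.
    by rewrite mulr_sumr; apply: eq_bigr => m0 _; rewrite mulrCA.
  rewrite rowE opmul_path_operator.
  under eq_bigr do rewrite hatE' mulr_sumr.
  rewrite exchange_big /=; apply: eq_bigr => m0 _.
  under eq_bigr do rewrite mulrCA.
  rewrite -mulr_sumr -opmul_path_operator opmul_path_weight; congr (_ * _).
  by apply: eq_path_sum => m x y; rewrite /two_row /at0; case: ifP.
rewrite hatlE hatrE -sumrB.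
under [RHS]eq_bigr do rewrite -mulrBr -path_sum_at.
pose ML (x y : 'I_n.+1 * 'I_n.+1) : R[i] := M_loc q x.1 x.2 y.1 y.2.
have local m x y := two_row_commutator M M'' m x y u_generic.
rewrite -(path_sum_commutator (M := ML) (ord0, ord0) (j, j') local).
(* The row (0, 0) of [M_loc] vanishes, so only the sum with [M_loc] on the right survives. *)
rewrite asep_rate_suml /= subrr mulr0 subr0 pair_big /=.
by apply: eq_bigr => -[i i'] _; rewrite !rowE opmul_path_weight.
Qed.
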